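(* Let $P_{20}=\{231,312,321\}$. For every $n\ge 1$, the number of perfect matchings on $[2n]$ that avoid $P_{20}$ is the Fuss--Catalan number $$|\mathcal{M}_n(P_{20})|=\frac{1}{3n+1}\binom{3n+1}{n}.$$
   Context: $[2n]=\{1,\dots,2n\}$. A perfect matching on $[2n]$ is a partition of $[2n]$ into $n$ pairs (arcs); for an arc $B$, $o(B)$ is its smaller (opening) and $c(B)$ its larger (closing) vertex. A matching contains a pattern $p=p_1p_2p_3\in\mathfrak{S}_3$ if it has three arcs $B_1,B_2,B_3$ with $o(B_1)<o(B_2)<o(B_3)$, with all three opening vertices smaller than all three closing vertices, and with $c(B_i)<c(B_j)\iff p_i>p_j$ for all $i,j\in\{1,2,3\}$. Thus, as matchings on $[6]$: $123$ is $\{(1,6),(2,5),(3,4)\}$, $132$ is $\{(1,6),(2,4),(3,5)\}$, $213$ is $\{(1,5),(2,6),(3,4)\}$, $231$ is $\{(1,5),(2,4),(3,6)\}$, $312$ is $\{(1,4),(2,6),(3,5)\}$, $321$ is $\{(1,4),(2,5),(3,6)\}$. A matching avoids a set $P$ of patterns if it contains none of them; $\mathcal{M}_n(P)$ is the set of perfect matchings on $[2n]$ avoiding $P$. *)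

(* Defs.v *)
From mathcomp Require Import all_boot all_order all_fingroup all_algebra.

Set Implicit Arguments.
Unset Strict Implicit.
Unset Printing Implicit Defensive.

(* The vertices 1, ..., m are encoded, in the same order, as the elements
   0, ..., m.-1 of 'I_m. *)
Definition perfect_matching (m : nat) (M : {set {set 'I_m}}) : bool :=
  partition M [set: 'I_m] && [forall B in M, #|B| == 2].

(* Vertices are smaller than m, so the neutral element m does not affect the
   minimum over a nonempty arc. *)
Definition opening (m : nat) (B : {set 'I_m}) : nat :=
  \big[minn/m]_(i in B) (i : nat).

Definition closing (m : nat) (B : {set 'I_m}) : nat :=
  \max_(i in B) (i : nat).

Definition contains_pattern (m : nat) (M : {set {set 'I_m}}) (p : 'S_3) : bool :=
  [exists B : {ffun 'I_3 -> {set 'I_m}},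
    [&& [forall i, B i \in M],
        [forall i : 'I_3, forall j : 'I_3,
           (i < j) ==> (opening (B i) < opening (B j))],
        [forall i, forall j, opening (B i) < closing (B j)]
      & [forall i, forall j,
           (closing (B i) < closing (B j)) == (p j < p i)]]].

Definition avoids (m : nat) (M : {set {set 'I_m}}) (P : {set 'S_3}) : bool :=
  [forall p in P, ~~ contains_pattern M p].

Definition avoiding_matchings (n : nat) (P : {set 'S_3}) :
    {set {set {set 'I_(2 * n)}}} :=
  [set M | perfect_matching M && avoids M P].

(* The word p_1 p_2 p_3, with letters in {1, 2, 3}. *)
Definition one_line (p : 'S_3) : seq nat := [seq (p i).+1 | i <- enum 'I_3].

Definition P20 : {set 'S_3} :=
  [set p | one_line p \in [:: [:: 2; 3; 1]; [:: 3; 1; 2]; [:: 3; 2; 1]]].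

(* Main.v *)
Require Import Defs.
From mathcomp Require Import all_boot all_order all_fingroup all_algebra.
From mathcomp Require Import zify ring.

Set Implicit Arguments.
Unset Strict Implicit.
Unset Printing Implicit Defensive.

(** The three patterns 231, 312, 321 are exactly the permutations of three
    letters with p_3 < p_1 ([in_P20]). Hence a matching contains one of them iff
    it has arcs B1, B2, B3, opening in this order and all open at once, such that
    B1 closes before B3 ([avoids_P20P]).

    Read the vertices from left to right and keep the open arcs on a stack, the
    most recently opened on top. The arc that closes at a given vertex cannot
    have two open arcs above it, so it is the top arc k or the one just below
    it. In the second case k must not have been crossed before, that is, no
    older arc may have closed since k was opened: the offending arc, the arc
    now closing and k would form a forbidden triple. Conversely, when every
    closing obeys this rule, no forbidden triple exists. A matching is encoded
    by the word that has at each vertex the opening of its arc; this is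
    injective, and the words of the avoiding matchings are those produced by
    the rule that leave no arc open ([closed_valid_words_matching],
    [valid_words_no_skip], [no_skip_valid_words]).

    How a word can be completed depends only on the stack of bits telling which
    open arcs have been crossed. Let F be the series with F = 1 + z F^3, and z
    mark each opening. The completions from a stack have a generating function
    that is F times a product along the stack: a crossed arc, or one alone on
    the stack, contributes F^2, and an uncrossed arc on top of another one gives
    F^2 if it closes first, and F^3 for the two together if the lower one does
    (a factor F for what happens before the lower arc closes, then F^2 for the
    remaining, now crossed, arc). Such a product obeys the recursion of the
    completions because F^(r+1) = F^r + z F^(r+3) ([completions_weight]).
    From the empty stack there remains F itself, whose coefficients are given by
    the closed form of the Raney numbers ([raney_closed_form]). *)

(** * Raney numbers and stacks *)

(** The coefficient of z^k in F^r, where F = 1 + z F^3: the recursion unrolls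
    F^r = 1 + z (F^3 + ... + F^(r+2)). *)
Fixpoint raney (k r : nat) : nat :=
  if k is k'.+1 then \sum_(i < r) raney k' i.+3 else 1.

Lemma raneyS k r : raney k.+1 r.+1 = raney k.+1 r + raney k r.+3.
Proof. by rewrite /= big_ord_recr. Qed.

(** The Raney formula, multiplied out to stay in the natural numbers. Both
    sides satisfy the recursion [raneyS]; on the binomial side this is a
    consequence of the Pascal rule and of the ratio of consecutive binomial
    coefficients. *)
Lemma raney_closed_form k r :
  (3 * k + r) * raney k r = r * 'C(3 * k + r, k).
Proof.
elim: k r => [|k IHk] r; first by rewrite /= bin0.
elim: r => [|r IHr]; first by rewrite /= big_ord0 !muln0 mul0n.
rewrite raneyS.
have := IHk r.+3; move: IHr.
set a := raney k.+1 r; set b := raney k r.+3.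
have -> : 3 * k + r.+3 = (3 * k.+1 + r) by lia.
have -> : 3 * k.+1 + r.+1 = (3 * k.+1 + r).+1 by lia.
have E1 := binS (3 * k.+1 + r) k.
have E2 := mul_bin_left (3 * k.+1 + r) k.
rewrite E1; move: E2 => {E1}.
have -> : 3 * k.+1 + r - k = 2 * k + r + 3 by lia.
set x := 'C(_, _); set y := 'C(_, _) => E2 E3 E4.
(* The two induction hypotheses determine a and b only up to the factor
   3k + 3 + r, so the goal is multiplied by it. *)
apply/eqP; rewrite -(@eqn_pmul2l (3 * k.+1 + r)); last by lia.
apply/eqP.
have -> : (3 * k.+1 + r) * ((3 * k.+1 + r).+1 * (a + b)) =
  (3 * k.+1 + r).+1 * ((3 * k.+1 + r) * a + (3 * k.+1 + r) * b) by ring.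
rewrite E3 E4.
nia.
Qed.

(** The coefficient of z^k in F^r times the product attached to the stack s,
    whose head is the top and where [true] stands for a crossed arc. *)
Fixpoint weight (s : seq bool) (r k : nat) : nat :=
  if s is x :: s' then
    weight s' r.+2 k +
    (if (x, s') is (false, _ :: s'') then weight s'' r.+3 k else 0)
  else raney k r.

Lemma weight_crossed s r k : weight (true :: s) r k = weight s r.+2 k.
Proof. by rewrite /= addn0. Qed.

Lemma weight_uncrossed y s r k :
  weight (false :: y :: s) r k = weight (y :: s) r.+2 k + weight s r.+3 k.
Proof. by []. Qed.

(** The identity F^(r+1) = F^r + z F^(r+3), which [weight] inherits since it
    is a sum of coefficients of powers of F. *)
Lemma weightS s r k : weight s r.+1 k.+1 = weight s r k.+1 + weight s r.+3 k.
Proof.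
have [p] := ubnP (size s); elim: p s r => // p IHp [|x [|y s]] r; rewrite ltnS.
- by rewrite /= big_ord_recr.
- by case: x => /= _; rewrite !addn0 big_ord_recr.
move=> sz; have sz1 : size (y :: s) < p := sz.
case: x {sz}; first by rewrite !weight_crossed IHp.
by rewrite !weight_uncrossed IHp // (IHp s) 1?ltnW // addnACA.
Qed.

Lemma weight0 s r r' : weight s r 0 = weight s r' 0.
Proof.
have [p] := ubnP (size s).
elim: p s r r' => // p IHp [|x [|y s]] r r'; rewrite ltnS => sz //.
case: x sz => sz; first by rewrite !weight_crossed; apply: IHp.
by rewrite !weight_uncrossed; congr (_ + _); apply: IHp; rewrite // ltnW.
Qed.

(** The number of ways to read m more letters and end with an empty stack. The
    next letter opens an arc, closes the top arc, or closes the arc below an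
    uncrossed top, which then becomes crossed. *)
Fixpoint completions (m : nat) (s : seq bool) : nat :=
  if m is m'.+1 then
    completions m' (false :: s) +
    (if s is x :: s' then completions m' s' +
       (if (x, s') is (false, _ :: s'')
        then completions m' (true :: s'') else 0)
     else 0)
  else nilp s.

Lemma completions_small m s : m < size s -> completions m s = 0.
Proof.
elim: m s => [|m IHm] [|x s] //= sz; rewrite !IHm //=; try lia.
by case: x; case: s sz => // y s sz; rewrite IHm.
Qed.

(** With k arcs still to be opened, the remaining letters are k openings and
    [size s + k] closings. *)
Lemma completions_weight k s : completions (size s + k.*2) s = weight s 1 k.
Proof.
move Em: (size s + k.*2) => m; elim: m k s Em => [|m IHm] k s Em.
  by case: s Em => //; case: k.
have opn : completions m (false :: s) =
    if k is k'.+1 then weight (false :: s) 1 k' else 0.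
  case: k Em => [|k] Em; first by rewrite completions_small //=; lia.
  by apply: IHm; rewrite /=; lia.
case: s Em opn => [|x s] Em; rewrite [completions m.+1 _]/= => ->.
  case: k Em => // k Em; rewrite [RHS]/= big_ord_recr big_ord0 /=; lia.
rewrite (IHm k s); last by move: Em => /=; lia.
have E3 t : weight t 3 k =
    weight t 1 k + (if k is k'.+1 then weight t 5 k' + weight t 4 k' else 0).
  case: (k) => [|k']; first by rewrite addn0; apply: weight0.
  by rewrite !weightS; lia.
have E4 t : weight t 4 k =
    weight t 3 k + (if k is k'.+1 then weight t 6 k' else 0).
  case: (k) => [|k']; first by rewrite addn0; apply: weight0.
  by rewrite !weightS; lia.
case: s Em => [|y s] Em.
  by have := E3 [::]; case: x Em => /= _ ->; case: (k) => [|k'] /=; lia.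
case: x Em => Em.
  rewrite weight_crossed E3.
  by case: (k) => [|k']; rewrite ?weight_uncrossed ?weight_crossed; lia.
rewrite (IHm k (true :: s)); last by move: Em => /=; lia.
rewrite weight_uncrossed E3 E4 weight_crossed.
by case: (k) => [|k']; rewrite ?weight_uncrossed; lia.
Qed.

(** * Words produced by the stack rule *)

(** In an opening word, the letter i occurs first at the vertex i, where the
    arc opens, and a second time where it closes: the open arcs are the letters
    that occur once. They are listed from the top of the stack. *)
Definition open_arcs (w : seq nat) : seq nat :=
  [seq i <- rev (iota 0 (size w)) | count_mem i w == 1].

(** An arc older than k has closed since k was opened. *)
Definition crossed (w : seq nat) (k : nat) : bool := has (gtn k) (drop k w).

(** The letters that may follow w: a new arc, the top arc k, or the arc just
    below k if k has not been crossed. *)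
Definition next_letters (w : seq nat) : seq nat :=
  size w ::
  (if open_arcs w is k :: s then
     k :: (if (crossed w k, s) is (false, i :: _) then [:: i] else [::])
   else [::]).

Lemma mem_open_arcs w i :
  (i \in open_arcs w) = (i < size w) && (count_mem i w == 1).
Proof. by rewrite mem_filter mem_rev mem_iota andbC. Qed.

Lemma gtn_trans : transitive gtn.
Proof. by move=> x y z /= yx xz; apply: ltn_trans xz yx. Qed.

Lemma open_arcs_sorted w : sorted gtn (open_arcs w).
Proof.
by apply: (sorted_filter gtn_trans); rewrite rev_sorted iota_ltn_sorted.
Qed.

Lemma open_arcs_uniq w : uniq (open_arcs w).
Proof. by rewrite filter_uniq // rev_uniq iota_uniq. Qed.

Lemma open_arcs_below_top w k s i :
  open_arcs w = k :: s -> i \in s -> i < k.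
Proof.
move=> E; have := open_arcs_sorted w; rewrite E /= => P.
by have /allP/(_ i) := order_path_min gtn_trans P; apply.
Qed.

Lemma open_arcs_below_second w k h s i :
  open_arcs w = k :: h :: s -> i \in s -> i < h.
Proof.
move=> E; have := open_arcs_sorted w; rewrite E /= => /andP[_ P].
by have /allP/(_ i) := order_path_min gtn_trans P; apply.
Qed.


(** The bound on the letters ensures that the letter [size w] is new. *)
Lemma open_arcs_open w : all (gtn (size w)) w ->
  open_arcs (rcons w (size w)) = size w :: open_arcs w.
Proof.
move=> bw; rewrite /open_arcs size_rcons.
rewrite -[in iota _ _]addn1 iotaD rev_cat /= -cats1.
rewrite count_cat /= eqxx (count_memPn _) ?addn0 //; last first.
  by apply/negP => /(allP bw); rewrite /= ltnn.
congr cons; apply: eq_in_filter => i; rewrite mem_rev mem_iota => /andP[_ lt_i].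
by rewrite count_cat /= addn0 (gtn_eqF lt_i) addn0.
Qed.

Lemma open_arcs_close w x : all (gtn (size w)) w -> x \in open_arcs w ->
  open_arcs (rcons w x) = rem x (open_arcs w).
Proof.
move=> bw; rewrite mem_open_arcs => /andP[lt_x /eqP x1].
rewrite rem_filter ?open_arcs_uniq // /open_arcs size_rcons.
rewrite -[in iota _ _]addn1 iotaD.
rewrite rev_cat /= -cats1 count_cat /= (ltn_eqF lt_x) (count_memPn _) /=.
  rewrite -filter_predI; apply: eq_filter => i /=.
  rewrite count_cat /= addn0 [x == i]eq_sym.
  by case: (eqVneq i x) => [->|_]; rewrite ?x1 ?addn0.
by apply/negP => /(allP bw); rewrite /= ltnn.
Qed.

Lemma crossed_rcons w x k : k <= size w ->
  crossed (rcons w x) k = (x < k) || crossed w k.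
Proof. by move=> le_k; rewrite /crossed drop_rcons // has_rcons. Qed.

Definition marks (w : seq nat) : seq bool :=
  [seq crossed w k | k <- open_arcs w].

(** Appending a letter acts on the stack of marks as in the recursion of
    [completions]: a new arc is uncrossed, closing the top arc crosses nothing,
    and closing the second arc crosses the top one only. *)
Lemma completions_next m w : all (gtn (size w)) w ->
  \sum_(x <- next_letters w) completions m (marks (rcons w x)) =
  completions m.+1 (marks w).
Proof.
move=> bw; rewrite big_cons [completions m.+1 _]/=; congr (_ + _).
  congr completions; rewrite /marks open_arcs_open //= crossed_rcons // ltnn /=.
  rewrite /crossed drop_size /=; congr cons; apply/eq_in_map => k.
  rewrite mem_open_arcs => /andP[lt_k _].
  by rewrite -!/(crossed _ _) crossed_rcons ?(ltnW lt_k) // ltnNge (ltnW lt_k).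
rewrite [marks w]/marks; case E: (open_arcs w) => [|k s]; first by rewrite big_nil.
have lt_ks i : i \in s -> i < k by apply: open_arcs_below_top E.
have lt_w i : i \in k :: s -> i <= size w.
  by rewrite -E mem_open_arcs => /andP[/ltnW].
rewrite big_cons /=; congr (_ + _).
  congr completions; rewrite /marks open_arcs_close ?E ?mem_head //= eqxx.
  apply/eq_in_map => i si; rewrite crossed_rcons ?lt_w ?inE ?si ?orbT //.
  by rewrite ltnNge ltnW ?lt_ks.
case: (crossed w k); first by rewrite big_nil.
case: s E lt_ks lt_w => [|i s] E lt_ks lt_w /=; first by rewrite big_nil.
rewrite big_seq1 /marks open_arcs_close ?E ?inE ?eqxx ?orbT //=.
have lt_ik : i < k by apply: lt_ks; rewrite mem_head.
rewrite (gtn_eqF lt_ik) /= eqxx crossed_rcons ?lt_w ?mem_head // lt_ik.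
congr (completions m (_ :: _)); apply/eq_in_map => j sj.
rewrite crossed_rcons ?lt_w ?inE ?sj ?orbT //.
by rewrite ltnNge ltnW // (open_arcs_below_second E).
Qed.

Fixpoint valid_words (m : nat) : seq (seq nat) :=
  if m is m'.+1 then [seq rcons w x | w <- valid_words m', x <- next_letters w]
  else [:: [::]].

Lemma valid_wordsP m w :
  reflect (size w = m /\
           forall c, c < m -> nth 0 w c \in next_letters (take c w))
          (w \in valid_words m).
Proof.
elim: m w => [|m IHm] w.
  rewrite inE; apply: (iffP eqP) => [-> //|[/size0nil //]].
apply: (iffP allpairsPdep) => [[v [x [/IHm[sz Hv] xv ->]]]|[]].
  split=> [|c]; first by rewrite size_rcons sz.
  rewrite ltnS leq_eqVlt => /predU1P[->|lt_c].
    by rewrite nth_rcons sz ltnn eqxx -sz -cats1 take_size_cat.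
  by rewrite nth_rcons sz lt_c -cats1 takel_cat ?Hv // sz ltnW.
case/lastP: w => // v x; rewrite size_rcons => -[sz] Hv.
exists v, x; split=> //; last first.
  have := Hv m (ltnSn m).
  by rewrite nth_rcons sz ltnn eqxx -sz -cats1 take_size_cat.
apply/IHm; split=> // c lt_c; have := Hv c (ltnW lt_c).
by rewrite nth_rcons sz lt_c -cats1 takel_cat // sz ltnW.
Qed.

Lemma mem_next_letters w x :
  x \in next_letters w -> x = size w \/ x \in open_arcs w.
Proof.
rewrite inE => /predU1P[-> //|xs]; [by left | right].
case: (open_arcs w) xs => [|k s] //.
rewrite !inE => /predU1P[->|]; rewrite ?eqxx //.
by case: (crossed w k) => //; case: s => // i s; rewrite !inE => ->; rewrite orbT.
Qed.

Lemma next_letters_le w x : x \in next_letters w -> x <= size w.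
Proof.
case/mem_next_letters=> [-> //|]; by rewrite mem_open_arcs => /andP[/ltnW].
Qed.

Lemma next_letters_uniq w : uniq (next_letters w).
Proof.
have lt_w i : i \in open_arcs w -> i < size w.
  by rewrite mem_open_arcs => /andP[].
rewrite /next_letters; case E: (open_arcs w) lt_w => [|k s] //= lt_w.
have lt_k : k < size w by rewrite lt_w ?mem_head.
case: (crossed w k) => /=; first by rewrite inE gtn_eqF.
case: s E lt_w => [|i s] E lt_w /=; first by rewrite inE gtn_eqF.
have lt_ik : i < k by apply: open_arcs_below_top E _; rewrite mem_head.
by rewrite !inE !gtn_eqF ?lt_w ?inE ?eqxx ?orbT.
Qed.

Lemma valid_words_bounded m w : w \in valid_words m -> all (gtn (size w)) w.
Proof.
case/valid_wordsP=> sz Hw; apply/(all_nthP 0) => c lt_c /=.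
apply: leq_ltn_trans (lt_c); rewrite sz in lt_c.
by have := next_letters_le (Hw c lt_c); rewrite size_takel // sz ltnW.
Qed.

Lemma valid_words_uniq m : uniq (valid_words m).
Proof.
elim: m => // m IHm; apply: allpairs_uniq_dep => //.
  by move=> w _; apply: next_letters_uniq.
by move=> [w x] [w' x'] _ _ /= /rcons_inj[-> ->].
Qed.

Lemma sum_completions m k :
  \sum_(w <- valid_words m) completions k (marks w) = completions (k + m) [::].
Proof.
elim: m k => [|m IHm] k; first by rewrite addn0 big_seq1.
rewrite -addSnnS -IHm big_allpairs_dep [LHS]big_seq [RHS]big_seq.
by apply: eq_bigr => w /valid_words_bounded; apply: completions_next.
Qed.

(** * Valid words have no forbidden triple *)

(** By the first two conditions, each letter i occurs first at the vertex i, so these are the words of all perfect matchings. *)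
Definition matching_word (m : nat) (w : seq nat) : Prop :=
  size w = m /\
  forall c, c < m ->
    [/\ nth 0 w c <= c, nth 0 w (nth 0 w c) = nth 0 w c
      & count_mem (nth 0 w c) w = 2].

(** The forbidden triple read on the word: the arc i closes at c while the arc
    k > i is open, and an arc j strictly between them was still open when k
    was opened. *)
Definition skips_an_arc (m : nat) (w : seq nat) : Prop :=
  exists i j k c,
    [/\ i < j, c < m, nth 0 w c = i, j \in open_arcs (take k w)
      & k \in open_arcs (take c w)].

Lemma open_arcs_take w c k i : k <= c -> i < k -> nth 0 w i = i ->
  i \in open_arcs (take c w) -> i \in open_arcs (take k w).
Proof.
rewrite !mem_open_arcs => le_kc lt_ik wi /andP[lt_i /eqP count1].
have lt_iw : i < size w.
  by apply: leq_trans lt_i _; rewrite size_take_min geq_minr.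
have lt_it : i < size (take k w) by rewrite size_take_min leq_min lt_ik.
have it : i \in take k w by have := mem_nth 0 lt_it; rewrite nth_take // wi.
rewrite lt_it eqn_leq -has_count has_pred1 it andbT -count1.
by rewrite -(cat_take_drop k (take c w)) take_takel // count_cat leq_addr.
Qed.

(** The second of the two occurrences of the letter is at c, outside
    the prefix of length k. *)
Lemma open_arcs_before_closing m w c k :
  matching_word m w -> c < m -> nth 0 w c < k <= c ->
  nth 0 w c \in open_arcs (take k w).
Proof.
move=> [sz /(_ c)] Hw lt_cm /andP[lt_ik le_kc]; have [_ wi count2] := Hw lt_cm.
set i := nth 0 w c in wi count2 lt_ik *.
have lt_it : i < size (take k w).
  rewrite size_takel //; lia.
have it : i \in take k w by have := mem_nth 0 lt_it; rewrite nth_take // wi.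
rewrite mem_open_arcs lt_it eqn_leq -has_count has_pred1 it andbT.
rewrite -ltnS -count2 -{2}(cat_take_drop k w) count_cat -addn1 leq_add2l.
rewrite -has_count has_pred1 {1}/i -{1}(subnKC le_kc) -nth_drop mem_nth //.
by rewrite size_drop sz ltn_sub2r // (leq_ltn_trans le_kc).
Qed.

Lemma valid_words_arcs m w c : w \in valid_words m -> c < m ->
  [/\ nth 0 w c <= c, nth 0 w (nth 0 w c) = nth 0 w c
    & count_mem (nth 0 w c) w <= 2].
Proof.
elim: m w c => // m IHm w c /allpairsPdep[v [x [vv xv ->]]].
have [sz _] := valid_wordsP _ _ vv; have bv := valid_words_bounded vv.
have count0 : count_mem m v = 0.
  by apply/count_memPn/negP => /(allP bv); rewrite /= sz ltnn.
have opn i : i \in open_arcs v -> [/\ i < m, nth 0 v i = i & count_mem i v = 1].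
  rewrite mem_open_arcs sz => /andP[lt_i /eqP count1]; split=> //.
  have /(nthP 0)[d lt_d vd] : i \in v by rewrite -has_pred1 has_count count1.
  by rewrite sz in lt_d; have [_] := IHm v d vv lt_d; rewrite vd.
rewrite ltnS leq_eqVlt => /predU1P[->|lt_cm].
  rewrite [nth 0 (rcons v x) m]nth_rcons sz ltnn eqxx.
  rewrite nth_rcons -cats1 count_cat sz /= eqxx addn0.
  case/mem_next_letters: (xv) => [->|/opn[lt_x -> ->]].
    by rewrite sz ltnn eqxx count0.
  by rewrite lt_x; split=> //; apply: ltnW.
have [le_c vvc countc] := IHm v c vv lt_cm.
rewrite [nth 0 (rcons v x) c]nth_rcons sz lt_cm nth_rcons sz.
rewrite (leq_ltn_trans le_c lt_cm); split=> //.
rewrite -cats1 count_cat /= addn0.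
case/mem_next_letters: xv => [->|/opn[_ _ count1]].
  rewrite sz gtn_eqF ?addn0 //; exact: leq_ltn_trans le_c lt_cm.
by case: eqVneq => [<-|_]; rewrite ?count1 // addn0.
Qed.

Lemma closed_valid_words_matching m w :
  w \in valid_words m -> open_arcs w = [::] -> matching_word m w.
Proof.
move=> vw closed; have [sz _] := valid_wordsP _ _ vw; split=> // c lt_c.
have [le_c wc le2] := valid_words_arcs vw lt_c; split=> //.
apply/eqP; rewrite eqn_leq le2 ltn_neqAle -has_count has_pred1.
rewrite mem_nth ?sz // andbT eq_sym; apply/negP => count1.
have: nth 0 w c \in open_arcs w by rewrite mem_open_arcs count1 sz; lia.
by rewrite closed.
Qed.

Lemma matching_word_closed m w : matching_word m w -> open_arcs w = [::].
Proof.
case=> sz Hw; case E: (open_arcs w) => [|i s] //.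
have : i \in open_arcs w by rewrite E mem_head.
rewrite mem_open_arcs => /andP[_ /eqP count1].
have /(nthP 0)[c lt_c wc] : i \in w by rewrite -has_pred1 has_count count1.
by rewrite sz in lt_c; have [_ _] := Hw c lt_c; rewrite wc count1.
Qed.

(** When the arc i closes at c below an open k, the rule forces i to be second
    and k to be the uncrossed top. Then j, which lies between them, is already
    closed, and it closed after k was opened: it has crossed k. *)
Lemma valid_words_no_skip m w : w \in valid_words m -> ~ skips_an_arc m w.
Proof.
move=> vw [i [j [k [c [lt_ij lt_cm wc jk kc]]]]].
have [sz Hw] := valid_wordsP _ _ vw.
have sz_c : size (take c w) = c by rewrite size_takel // sz ltnW.
have lt_kc : k < c by move: kc; rewrite mem_open_arcs sz_c => /andP[].
have lt_jk : j < k.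
  by move: jk; rewrite mem_open_arcs size_takel ?sz; [case/andP | lia].
have := Hw c lt_cm; rewrite wc inE sz_c ltn_eqF /=; last by lia.
case E: (open_arcs (take c w)) => [|k' s] //.
have max_k : k <= k'.
  by move: kc; rewrite E inE => /predU1P[-> //|/(open_arcs_below_top E)/ltnW].
rewrite inE ltn_eqF /=; last by lia.
case: ifP => // cr; case: s E => // i' s E; rewrite inE => /eqP ii'.
have sorted_s l : l \in s -> l < i'.
  exact: open_arcs_below_second E.
have kk' : k = k'.
  move: kc; rewrite E !inE => /predU1P[//|/predU1P[|/sorted_s]]; lia.
have j_closed : j \notin open_arcs (take c w).
  rewrite E !inE; apply/negP => /predU1P[|/predU1P[|/sorted_s]]; lia.
case/negP: j_closed.
move: jk; rewrite !mem_open_arcs sz_c => /andP[_ /eqP count1].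
rewrite (ltn_trans lt_jk lt_kc) /= -(cat_take_drop k (take c w)) count_cat.
rewrite take_takel ?(ltnW lt_kc) // count1 (count_memPn _) //; apply/negP => jd.
by case/negP: (negbT cr); apply/hasP; exists j; rewrite // -kk'.
Qed.

(** Suppose that i closes at c, below the top k. If another open arc h lies
    between them, then i, h, k is a forbidden triple. If an arc a crossed k
    before, then the forbidden triple is a, i, k or i, a, k, according to the
    order of a and i. *)
Lemma no_skip_valid_words m w :
  matching_word m w -> ~ skips_an_arc m w -> w \in valid_words m.
Proof.
move=> mw noskip; have [sz Hw] := mw; apply/valid_wordsP; split=> // c lt_cm.
have sz_c : size (take c w) = c by rewrite size_takel // sz ltnW.
have [le_ic wi _] := Hw c lt_cm; set i := nth 0 w c in le_ic wi *.
rewrite inE sz_c; case: (ltngtP i c) le_ic => //= lt_ic _.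
have ic : i \in open_arcs (take c w).
  by apply: open_arcs_before_closing mw lt_cm _; rewrite lt_ic leqnn.
case E: (open_arcs (take c w)) (ic) => [|k s] //.
rewrite !inE => /predU1P[->|si]; first by rewrite eqxx.
have lt_ik := open_arcs_below_top E si; rewrite ltn_eqF //=.
have kc : k \in open_arcs (take c w) by rewrite E mem_head.
have lt_kc : k < c by move: kc; rewrite mem_open_arcs sz_c => /andP[].
have opn j : j \in open_arcs (take c w) -> nth 0 w j = j.
  rewrite mem_open_arcs => /andP[_ /eqP count1].
  have : j \in take c w by rewrite -has_pred1 has_count count1.
  by move/mem_take/(nthP 0) => [d]; rewrite sz => /Hw[_ wd _] <-.
case: ifP => [/hasP[a ad /= lt_ak]|_]; last first.
  case: s E si => // h s E; rewrite !inE => /predU1P[->|si]; first by rewrite eqxx.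
  case: noskip; exists i, h, k, c; split=> //.
    exact: open_arcs_below_second E si.
  have hc : h \in open_arcs (take c w) by rewrite E !inE eqxx orbT.
  apply: open_arcs_take (ltnW lt_kc) _ (opn h hc) hc.
  by apply: open_arcs_below_top E _; rewrite mem_head.
case: noskip; move/(nthP 0): ad => [d']; rewrite size_drop sz_c ltn_subRL => lt_d.
rewrite nth_drop nth_take //; set d := k + d' in lt_d * => wd.
have lt_dm : d < m by apply: ltn_trans lt_cm.
have lt_kd : k < d.
  rewrite ltn_neqAle leq_addr andbT; apply/negP => /eqP kd.
  by move: wd lt_ak; rewrite -kd opn // => ->; rewrite ltnn.
have ak : a \in open_arcs (take k w).
  by rewrite -wd; apply: open_arcs_before_closing mw lt_dm _; rewrite wd lt_ak ltnW.
case: (ltngtP a i) => [lt_ai|lt_ia|eq_ai].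
- exists a, i, k, d; split=> //.
    exact: open_arcs_take (ltnW lt_kc) lt_ik wi ic.
  exact: open_arcs_take (ltnW lt_d) lt_kd (opn k kc) kc.
- by exists i, a, k, c.
(* If a = i, then i would already have closed at d < c. *)
have : i \in open_arcs (take c w) by [].
rewrite mem_open_arcs -(cat_take_drop k (take c w)) count_cat.
rewrite take_takel ?(ltnW lt_kc) //.
move: ak; rewrite eq_ai mem_open_arcs => /andP[_ /eqP->].
case/andP=> _; rewrite -[_ == 1]/(_.+1 == 1) eqSS => /eqP/count_memPn/negP; case.
rewrite -eq_ai -wd; apply/(nthP 0); exists d'.
  by rewrite size_drop sz_c ltn_subRL.
by rewrite nth_drop nth_take.
Qed.

(** * Matchings and their opening words *)

Definition opening_word (m : nat) (M : {set {set 'I_m}}) : seq nat :=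
  [seq opening (pblock M c) | c <- enum 'I_m].

Lemma size_opening_word m (M : {set {set 'I_m}}) : size (opening_word M) = m.
Proof. by rewrite size_map size_enum_ord. Qed.

Lemma nth_opening_word m (M : {set {set 'I_m}}) (c : 'I_m) :
  nth 0 (opening_word M) c = opening (pblock M c).
Proof. by rewrite (nth_map c) ?size_enum_ord // nth_ord_enum. Qed.

Lemma count_map_enum (T : finType) (f : T -> nat) x :
  count_mem x [seq f c | c <- enum T] = #|[set c | f c == x]|.
Proof.
rewrite count_map -size_filter cardsE cardE; congr size.
by rewrite enumT [RHS]/enum_mem.
Qed.

Lemma opening_le m (B : {set 'I_m}) (x : 'I_m) : x \in B -> opening B <= x.
Proof.
move=> Bx; rewrite /opening; have := mem_index_enum x.
elim: (index_enum _) => // y s IHs; rewrite inE big_cons => /predU1P[<-|sx].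
  by rewrite Bx geq_minl.
by case: ifP => _; rewrite ?geq_min IHs ?orbT.
Qed.

Lemma opening_attained m (B : {set 'I_m}) (x : 'I_m) :
  x \in B -> exists2 y : 'I_m, y \in B & opening B = y.
Proof.
move=> Bx; have : opening B = m \/ exists2 y : 'I_m, y \in B & opening B = y.
  rewrite /opening; elim/big_rec: _ => [|y v By IHv]; first by left.
  case: (leqP y v) => _; last exact: IHv.
  by right; exists y.
by case=> // Em; have := opening_le Bx; rewrite Em leqNgt ltn_ord.
Qed.

Lemma arc_endpoints m (B : {set 'I_m}) : #|B| = 2 ->
  exists x y : 'I_m, [/\ x < y, B = [set x; y], opening B = x & closing B = y].
Proof.
move/eqP/cards2P => [x [y [neq ->]]].
wlog lt_xy : x y neq / x < y => [IH|].
  case: (ltngtP x y) neq => [lt|lt|/val_inj->] neq; last by rewrite eqxx in neq.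
    exact: IH.
  by rewrite setUC; apply: IH; rewrite // eq_sym.
exists x, y; split=> //.
  have xB : x \in [set x; y] by rewrite !inE eqxx.
  have [z zB Ez] := opening_attained xB; have := opening_le xB; rewrite Ez.
  by case/set2P: zB => -> //; rewrite leqNgt lt_xy.
rewrite /closing big_setU1 ?inE //= big_set1.
by apply/maxn_idPr/ltnW.
Qed.

Section PerfectMatching.

Variables (m : nat) (M : {set {set 'I_m}}).
Hypothesis pmM : perfect_matching M.

Let partM : partition M [set: 'I_m].
Proof. by case/andP: pmM. Qed.

Let tiM : trivIset M.
Proof. by case/and3P: partM. Qed.

Lemma in_cover_matching x : x \in cover M.
Proof. by rewrite (cover_partition partM) inE. Qed.

Lemma arcP B : B \in M ->
  exists x y : 'I_m, [/\ x < y, B = [set x; y], opening B = x & closing B = y].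
Proof.
by move=> MB; apply: arc_endpoints; case/andP: pmM => _ /forall_inP/(_ B MB)/eqP.
Qed.

Lemma pblock_in x : pblock M x \in M.
Proof. exact/pblock_mem/in_cover_matching. Qed.

Lemma in_pblock x : x \in pblock M x.
Proof. by rewrite mem_pblock in_cover_matching. Qed.

Lemma opening_inj : {in M &, injective (@opening m)}.
Proof.
move=> A B MA MB; have [x [y [_ EA -> _]]] := arcP MA.
have [x' [y' [_ EB -> _]]] := arcP MB => /val_inj xx'.
have xA : x \in A by rewrite EA !inE eqxx.
have xB : x \in B by rewrite EB xx' !inE eqxx.
by rewrite -(def_pblock tiM MA xA) (def_pblock tiM MB xB).
Qed.

Lemma closing_inj : {in M &, injective (@closing m)}.
Proof.
move=> A B MA MB; have [y [x [_ EA _ ->]]] := arcP MA.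
have [y' [x' [_ EB _ ->]]] := arcP MB => /val_inj xx'.
have xA : x \in A by rewrite EA !inE eqxx orbT.
have xB : x \in B by rewrite EB xx' !inE eqxx orbT.
by rewrite -(def_pblock tiM MA xA) (def_pblock tiM MB xB).
Qed.

Lemma opening_neq_closing A B : A \in M -> B \in M -> opening A != closing B.
Proof.
move=> MA MB; have [x [y [lt_xy EA Eo _]]] := arcP MA; rewrite Eo.
have [x' [y' [lt_xy' EB Eo' ->]]] := arcP MB; apply/eqP => /val_inj eq_xy'.
have xA : x \in A by rewrite EA !inE eqxx.
have xB : x \in B by rewrite EB eq_xy' !inE eqxx orbT.
have AB : A = B by rewrite -(def_pblock tiM MA xA) (def_pblock tiM MB xB).
by move: lt_xy'; rewrite -eq_xy' -Eo AB Eo' ltnn.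
Qed.

Lemma eq_opening_pblock (c : 'I_m) B : B \in M ->
  (opening (pblock M c) == opening B) = (c \in B).
Proof.
move=> MB; apply/eqP/idP => [/opening_inj <- //|cB].
- exact: in_pblock.
- exact: pblock_in.
by rewrite (def_pblock tiM MB).
Qed.

Lemma nth_opening_closing B : B \in M ->
  nth 0 (opening_word M) (closing B) = opening B.
Proof.
move=> MB; have [x [y [_ EB _ ->]]] := arcP MB.
by rewrite nth_opening_word (def_pblock tiM MB) // EB !inE eqxx orbT.
Qed.

Lemma closing_lt B : B \in M -> closing B < m.
Proof. by case/arcP => [x [y [_ _ _ ->]]]. Qed.

Lemma opening_word_matching : matching_word m (opening_word M).
Proof.
split=> [|c lt_c]; first exact: size_opening_word.
rewrite -[c]/(val (Ordinal lt_c)) nth_opening_word.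
set B := pblock M _; have MB : B \in M by apply: pblock_in.
have [x [y [lt_xy EB Eo _]]] := arcP MB; rewrite Eo; split.
- have : Ordinal lt_c \in B by apply: in_pblock.
  by rewrite EB !inE => /orP[]/eqP->; rewrite ?leqnn // ltnW.
- by rewrite nth_opening_word (def_pblock tiM MB) // EB !inE eqxx.
rewrite -Eo count_map_enum.
rewrite (_ : [set _ | _] = B); last first.
  by apply/setP => d; rewrite inE eq_opening_pblock.
by rewrite EB cards2 neq_ltn lt_xy.
Qed.

(** This turns [skips_an_arc] into inequalities between endpoints of arcs. *)
Lemma opening_open B k : B \in M -> k <= m ->
  (opening B \in open_arcs (take k (opening_word M))) =
  (opening B < k <= closing B).
Proof.
move=> MB le_k; apply/idP/idP => [|lt_k]; last first.
  rewrite -(nth_opening_closing MB); apply: open_arcs_before_closing (closing_lt MB) _.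
    exact: opening_word_matching.
  by rewrite nth_opening_closing.
rewrite mem_open_arcs size_takel ?size_opening_word // => /andP[-> /eqP count1] /=.
have [_ /(_ _ (closing_lt MB))[_ _]] := opening_word_matching.
rewrite nth_opening_closing // -(cat_take_drop k (opening_word M)).
rewrite count_cat count1 add1n => -[count1'].
have /(nthP 0)[d] : opening B \in drop k (opening_word M).
  by rewrite -has_pred1 has_count count1'.
rewrite size_drop size_opening_word ltn_subRL nth_drop => lt_d /eqP.
rewrite -[k + d]/(val (Ordinal lt_d)) nth_opening_word eq_opening_pblock //.
have [x [y [lt_xy -> _ ->]]] := arcP MB.
rewrite !inE => /orP[]/eqP/(congr1 val)/= Ed; first by lia.
by rewrite -Ed leq_addr.
Qed.

Lemma open_arc_opening k j : j \in open_arcs (take k (opening_word M)) ->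
  exists2 B, B \in M & j = opening B.
Proof.
rewrite mem_open_arcs => /andP[_ /eqP count1].
have /mem_take/mapP[c _ ->] : j \in take k (opening_word M).
  by rewrite -has_pred1 has_count count1.
by exists (pblock M c); first exact: pblock_in.
Qed.

Lemma skips_an_arcP :
  skips_an_arc m (opening_word M) <->
  exists B1 B2 B3, [/\ [/\ B1 \in M, B2 \in M & B3 \in M],
    opening B1 < opening B2 < opening B3,
    opening B3 < closing B1, opening B3 < closing B2 & closing B1 < closing B3].
Proof.
split=> [[i [j [k [c [lt_ij lt_c wc jk kc]]]]]|].
  have [B3 M3 k3] := open_arc_opening kc; rewrite {}k3 in jk kc *.
  have [B2 M2 j2] := open_arc_opening jk; rewrite {}j2 in lt_ij jk *.
  move: kc; rewrite opening_open // ?(ltnW lt_c) // => /andP[lt_3c le_c3].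
  move: jk; rewrite opening_open //; last by lia.
  move=> /andP[lt_23 le_32].
  rewrite -[c]/(val (Ordinal lt_c)) nth_opening_word in wc.
  have M1 := pblock_in (Ordinal lt_c); have in1 := in_pblock (Ordinal lt_c).
  set B1 := pblock M _ in wc M1 in1 *.
  have c1 : closing B1 = c.
    have [x [y [_ EB1 Eo ->]]] := arcP M1.
    move: in1; rewrite EB1 !inE => /orP[]/eqP/(congr1 val)/= ?; lia.
  have o1 := opening_neq_closing M3 M2.
  exists B1, B2, B3; rewrite wc lt_ij lt_23 c1 lt_3c; split=> //.
    by rewrite ltn_neqAle o1.
  rewrite ltn_neqAle le_c3 -c1 andbT; apply/eqP => /closing_inj E13.
  by move: wc; rewrite E13 //; lia.
case=> B1 [B2 [B3 [[M1 M2 M3] /andP[lt12 lt23] lt31 lt32 lt13]]].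
exists (opening B1), (opening B2), (opening B3), (closing B1).
rewrite nth_opening_closing // closing_lt // !opening_open ?(ltnW (closing_lt M1)) //.
  by rewrite lt12 lt23 lt31 (ltnW lt32) (ltnW lt13).
exact/ltnW/(ltn_trans lt31)/closing_lt.
Qed.

(** Two vertices are matched iff they carry the same letter, so the word
    determines the matching. *)
Lemma preim_partition_opening_word :
  preim_partition (fun c : 'I_m => nth 0 (opening_word M) c) [set: 'I_m] = M.
Proof.
rewrite -[RHS](preim_partition_pblock partM).
apply: eq_imset => x; apply/setP => y; rewrite !inE /=.
rewrite !nth_opening_word; apply/eqP/eqP => [|-> //].
by apply: opening_inj; apply: pblock_in.
Qed.

End PerfectMatching.

Section WordMatching.

Variables (m : nat) (w : seq nat).
Hypothesis mw : matching_word m w.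

Let M := preim_partition (fun c : 'I_m => nth 0 w c) [set: 'I_m].

Lemma pblock_word_matching (c : 'I_m) :
  pblock M c = [set d : 'I_m | nth 0 w d == nth 0 w c].
Proof.
apply/setP => d; rewrite inE eq_sym.
by rewrite pblock_equivalence_partition ?inE //; split=> // /eqP->.
Qed.

Lemma word_as_map : w = [seq nth 0 w (c : 'I_m) | c <- enum 'I_m].
Proof.
case: mw => sz _.
by rewrite (map_comp (nth 0 w) val) val_enum_ord -sz -/(mkseq _ _) mkseq_nth.
Qed.

Lemma word_matching_perfect : perfect_matching M.
Proof.
have partM := preim_partitionP (fun c : 'I_m => nth 0 w c) [set: 'I_m].
rewrite /perfect_matching partM; apply/forall_inP => B MB; apply/eqP.
have [_ tiM M0] := and3P partM.
have /set0Pn[c cB] : B != set0 by apply: contraNneq M0 => <-.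
rewrite -(def_pblock tiM MB cB) pblock_word_matching -count_map_enum -word_as_map.
by case: mw => _ /(_ c (ltn_ord c))[].
Qed.

(** Conversely, every matching word is the opening word of its partition into
    level sets: the letter at c is the smallest vertex carrying that letter. *)
Lemma opening_word_of_word : opening_word M = w.
Proof.
rewrite [RHS]word_as_map; apply: eq_map => c.
case: mw => _ Hw; have [le_c wi _] := Hw c (ltn_ord c).
have lt_i : nth 0 w c < m by apply: leq_ltn_trans le_c _.
have pm := word_matching_perfect.
have [x [y [lt_xy EB -> _]]] := arcP pm (pblock_in pm c).
have in_i : Ordinal lt_i \in pblock M c by rewrite pblock_word_matching inE /= wi.
have : x \in pblock M c by rewrite EB !inE eqxx.
rewrite pblock_word_matching inE => /eqP wx.
have [] := Hw x (ltn_ord x); rewrite wx => le_ix _ _; apply/eqP.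
rewrite eqn_leq le_ix andbT.
move: in_i; rewrite EB !inE => /orP[]/eqP/(congr1 val)/= ->//.
exact: ltnW.
Qed.

End WordMatching.

(** * Patterns *)

(** Send i to the rank of its value in decreasing order, the convention that
    relates patterns to closings. *)
Lemma standardization n (c : 'I_n -> nat) : injective c ->
  exists p : 'S_n, forall i j, (c i < c j) = (p j < p i).
Proof.
move=> c_inj; pose r i := #|[set j | c i < c j]|.
have r_lt i : r i < n.
  rewrite -[n in _ < n]card_ord -cardsT; apply/proper_card/properP.
  by split; [apply: subsetT | exists i; rewrite !inE ?ltnn].
have r_mono i j : c i < c j -> r j < r i.
  move=> lt_ij; apply/proper_card/properP; split.
    by apply/subsetP => k; rewrite !inE; apply: ltn_trans.
  by exists j; rewrite !inE ?ltnn.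
have r_inj : injective (fun i => Ordinal (r_lt i)).
  move=> i j /(congr1 val)/= eq_r; apply: c_inj.
  by case: (ltngtP (c i) (c j)) => // /r_mono; rewrite eq_r ltnn.
exists (perm r_inj) => i j; rewrite !permE /=.
case: (ltngtP (c i) (c j)) => [/r_mono->//|/r_mono/ltnW|/c_inj->].
  by rewrite leqNgt => /negbTE.
by rewrite ltnn.
Qed.

Lemma in_P20 (p : 'S_3) : (p \in P20) = (p ord_max < p ord0).
Proof.
pose i1 : 'I_3 := Ordinal (isT : 1 < 3).
have -> : (p \in P20) = ([:: (p ord0).+1; (p i1).+1; (p ord_max).+1] \in
   [:: [:: 2; 3; 1]; [:: 3; 1; 2]; [:: 3; 2; 1]]).
  rewrite inE /one_line (_ : enum 'I_3 = [:: ord0; i1; ord_max]) //.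
  by apply: (inj_map val_inj); rewrite val_enum_ord.
have : uniq [:: p ord0; p i1; p ord_max].
  by rewrite (map_inj_uniq (@perm_inj _ p) [:: ord0; i1; ord_max]).
by case: (p ord0) => [[|[|[|?]]] ?] //; case: (p i1) => [[|[|[|?]]] ?] //;
   case: (p ord_max) => [[|[|[|?]]] ?].
Qed.

(** Given a forbidden triple, the position of the closing of B2 selects which of
    the three patterns occurs; standardizing the closings yields it without a
    case distinction. *)
Lemma avoids_P20P m (M : {set {set 'I_m}}) : perfect_matching M ->
  avoids M P20 <-> ~ skips_an_arc m (opening_word M).
Proof.
move=> pmM; rewrite skips_an_arcP //; split.
  move=> /forall_inP avM [B1 [B2 [B3 [[M1 M2 M3]]]]].
  move=> /andP[lt12 lt23] lt31 lt32 lt13.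
  pose B := [ffun i : 'I_3 => nth set0 [:: B1; B2; B3] i].
  have MB i : B i \in M by rewrite ffunE; case: i => [[|[|[|?]]] ?].
  have B_inj : injective (fun i => closing (B i)).
    move=> i j /(closing_inj pmM (MB i) (MB j))/(congr1 (@opening m)).
    rewrite !ffunE; case: i => [[|[|[|?]]] ?]; case: j => [[|[|[|?]]] ?] //= eqo;
      try (by apply: val_inj); lia.
  have [p Hp] := standardization B_inj.
  have /avM/negP : p \in P20 by rewrite in_P20 -Hp !ffunE.
  case; apply/existsP; exists B; apply/and4P; split; apply/forallP => i //.
  - apply/forallP => j; apply/implyP; rewrite !ffunE.
    by case: i => [[|[|[|?]]] ?]; case: j => [[|[|[|?]]] ?] //= _; lia.
  - apply/forallP => j; rewrite !ffunE.
    by case: i => [[|[|[|?]]] ?]; case: j => [[|[|[|?]]] ?] //=; lia.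
  by apply/forallP => j; rewrite Hp.
move=> no3; apply/forall_inP => p; rewrite in_P20 => lt_p; apply/negP.
case/existsP => B /and4P[/forallP MB /forallP lt_o /forallP lt_oc /forallP cl].
pose i1 : 'I_3 := Ordinal (isT : 1 < 3).
have oo (i j : 'I_3) : i < j -> opening (B i) < opening (B j).
  by apply/implyP/(forallP (lt_o i)).
have oc i j : opening (B i) < closing (B j) by apply/(forallP (lt_oc i)).
apply: no3; exists (B ord0), (B i1), (B ord_max); rewrite !MB !oc !oo //.
by split=> //; rewrite (eqP (forallP (cl _) _)).
Qed.

(** * Counting *)

Lemma card_avoiding_matchings n : #|avoiding_matchings n P20| = raney n 1.
Proof.
pose good := [seq w <- valid_words (2 * n) | nilp (open_arcs w)].
have -> : #|avoiding_matchings n P20| = size good.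
  rewrite cardE -(size_map (@opening_word (2 * n))); apply/perm_size/uniq_perm.
  - rewrite map_inj_in_uniq ?enum_uniq // => M M'.
    rewrite !mem_enum !inE => /andP[pm _] /andP[pm' _] eqw.
    by rewrite -(preim_partition_opening_word pm) eqw preim_partition_opening_word.
  - by rewrite filter_uniq ?valid_words_uniq.
  move=> w; rewrite mem_filter; apply/mapP/andP.
    case=> M; rewrite mem_enum inE => /andP[pm av] ->.
    have mw := opening_word_matching pm.
    rewrite (matching_word_closed mw); split=> //.
    by apply: no_skip_valid_words mw _; apply/(avoids_P20P pm).
  case=> /nilP closed vw; have mw := closed_valid_words_matching vw closed.
  have pm := word_matching_perfect mw; have Ew := opening_word_of_word mw.
  exists (preim_partition (fun c : 'I_(2 * n) => nth 0 w c) setT) => //.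
  rewrite mem_enum inE pm; apply/avoids_P20P => //; rewrite Ew.
  exact: valid_words_no_skip vw.
rewrite -[RHS]/(weight [::] 1 n) -completions_weight add0n -mul2n.
rewrite -[X in completions X]add0n -sum_completions.
rewrite size_filter -sum1_count big_mkcond /=.
by apply: eq_bigr => w _; rewrite /marks; case: (open_arcs w).
Qed.

Theorem theorem27 (n : nat) (hn : 1 <= n) :
  (#|avoiding_matchings n P20|%:R
   = 1 / (3 * n + 1)%N%:R * 'C(3 * n + 1, n)%:R :> rat)%R.
Proof.
have E := raney_closed_form n 1; rewrite mul1n in E.
rewrite card_avoiding_matchings -E GRing.natrM GRing.mulrA GRing.div1r.
by rewrite GRing.mulVf ?GRing.mul1r // Num.Theory.pnatr_eq0 addn1.
Qed.
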